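(* Assume $R^{\mathsf A}[U|V]\otimes R^{\mathsf A}[W|V]\in L^2(\mathbb P;\mathsf L_2(\mathcal F;\mathcal G))$. Then $$\mathrm{Cov}[U,W]=\mathrm{Cov}\big[\mathbb E^{\mathsf A}[U|V],\mathbb E^{\mathsf A}[W|V]\big]+\mathbb E\big[\mathrm{Cov}^{\mathsf A}[U,W|V]\big].$$ Moreover, in the Loewner order of self-adjoint operators on $\mathcal G$, $$\mathrm{Cov}[U]\ \ge\ \mathrm{Cov}\big[\mathbb E[U|V]\big]\ \ge\ \mathrm{Cov}\big[\mathbb E^{\mathsf A}[U|V]\big]\ \ge\ 0.$$
   Context: Standing setup: - $(\Omega,\Sigma,\mathbb P)$ is a probability space and $\mathcal F,\mathcal G,\mathcal H$ are separable real Hilbert spaces. - $L^2(\mathbb P;\mathcal K)$ is the Bochner space of square-integrable $\mathcal K$-valued random variables. - $U\in L^2(\mathbb P;\mathcal G)$, $V\in L^2(\mathbb P;\mathcal H)$, $W\in L^2(\mathbb P;\mathcal F)$. - For $g\in\mathcal G$ and $f\in\mathcal F$, $g\otimes f:\mathcal F\to\mathcal G$ is given by $f'\mapsto\langle f,f'\rangle_{\mathcal F}\,g$. - $\mathrm{Cov}[U,W]=\mathbb E[(U-\mathbb E U)\otimes(W-\mathbb E W)]$ and $\mathrm{Cov}[U]=\mathrm{Cov}[U,U]$. - $\mathsf L_2(\mathcal F;\mathcal G)$ is the separable Hilbert space of Hilbert–Schmidt operators $\mathcal F\to\mathcal G$. - $\mathsf A(\mathcal H;\mathcal K)$ is the set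 of bounded affine maps $\mathcal H\to\mathcal K$. - $\overline{\mathsf A_{\mathcal K}\circ V}$ is the closure in $L^2(\mathbb P;\mathcal K)$ of $\{\gamma\circ V:\gamma\in\mathsf A(\mathcal H;\mathcal K)\}$. - For $Z\in L^2(\mathbb P;\mathcal K)$, $\mathbb E^{\mathsf A}[Z|V]$ is the orthogonal projection of $Z$ onto $\overline{\mathsf A_{\mathcal K}\circ V}$, and $R^{\mathsf A}[Z|V]:=Z-\mathbb E^{\mathsf A}[Z|V]$. - The linear conditional covariance is $\mathrm{Cov}^{\mathsf A}[U,W|V]:=\mathbb E^{\mathsf A}\big[R^{\mathsf A}[U|V]\otimes R^{\mathsf A}[W|V]\,\big|\,V\big]$, with $\mathcal K=\mathsf L_2(\mathcal F;\mathcal G)$. *)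

(* Defs.v *)
From HB Require Import structures.
From mathcomp Require Import all_boot all_order all_algebra.
From mathcomp Require Import all_classical all_reals all_analysis.
Set Implicit Arguments. Unset Strict Implicit. Unset Printing Implicit Defensive.
Import Order.TTheory GRing.Theory Num.Theory.
Local Open Scope classical_set_scope.
Local Open Scope ring_scope.

Section Hilbert.
Variables (R : realType) (V : lmodType R) (ip : V -> V -> R).

Definition nrm2 (x : V) : R := ip x x.

Definition is_separable_hilbert : Prop :=
  [/\ (forall x y, ip x y = ip y x),
      (forall a x y z, ip (a *: x + y) z = a * ip x z + ip y z),
      (forall x, 0 <= ip x x) /\ (forall x, ip x x = 0 -> x = 0),
      (forall u : nat -> V,
         (forall e : R, 0 < e -> exists N : nat, forall m n : nat,
              (N <= m)%N -> (N <= n)%N -> nrm2 (u m - u n) < e) ->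
         exists l : V, forall e : R, 0 < e -> exists N : nat, forall n : nat,
              (N <= n)%N -> nrm2 (u n - l) < e) &
      (exists s : nat -> V, forall (x : V) (e : R), 0 < e ->
         exists n : nat, nrm2 (x - s n) < e)].
End Hilbert.

(* Value spaces: a vector space with an inner product and a predicate of    *)
(* admissible elements (all of G, resp. the Hilbert-Schmidt operators in    *)
(* the function space F -> G).                                              *)
Record vspace (R : realType) := VSpace {
  vcar :> lmodType R;
  vip : vcar -> vcar -> R;
  vmem : vcar -> Prop }.

Definition hspace (R : realType) (G : lmodType R) (ip : G -> G -> R) : vspace R :=
  @VSpace R G ip (fun _ => True).

Definition tens (R : realType) (F G : lmodType R) (ipF : F -> F -> R)
  (g : G) (f : F) : F -> G := fun f' => ipF f f' *: g.

Section HS.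
Variables (R : realType) (F G : lmodType R) (ipF : F -> F -> R) (ipG : G -> G -> R).

Definition orthonormal (n : nat) (e : 'I_n -> F) : Prop :=
  forall i j : 'I_n, ipF (e i) (e j) = (i == j)%:R.

(* Squared Hilbert-Schmidt norm: sup over finite orthonormal families of
   sum_i ||A e_i||^2  (= sum over an orthonormal basis). *)
Definition hs_norm2 (A : F -> G) : \bar R :=
  ereal_sup [set x | exists (n : nat) (e : 'I_n -> F),
     orthonormal e /\ x = (\sum_(i < n) ipG (A (e i)) (A (e i)))%:E].

Definition is_linear_map (A : F -> G) : Prop :=
  forall (a : R) (x y : F), A (a *: x + y) = a *: A x + A y.

Definition is_HS (A : F -> G) : Prop :=
  is_linear_map A /\ (hs_norm2 A < +oo)%E.

(* Hilbert-Schmidt inner product (by polarization of the HS norm). *)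
Definition ip_HS (A B : F -> G) : R :=
  (fine (hs_norm2 (A + B)) - fine (hs_norm2 (A - B))) / 4%:R.

Definition HSspace : vspace R := @VSpace R (F -> G : lmodType R) ip_HS is_HS.
End HS.

Section Prob.
Variables (R : realType) (d : measure_display) (Omega : measurableType d)
  (P : probability Omega R).

Definition Ex (f : Omega -> R) : R := Rintegral P setT f.

(* Z in L^2(P; K): admissible values, (weakly = strongly, by Pettis and
   separability) measurable, and square-integrable norm. *)
Definition L2 (K : vspace R) (Z : Omega -> K) : Prop :=
  [/\ (forall w, vmem (Z w)),
      (forall v : K, vmem v -> measurable_fun setT (fun w => vip (Z w) v)) &
      P.-integrable setT (fun w => (nrm2 (@vip R K) (Z w))%:E)].

(* m = E[Z] (Bochner integral), characterized by <m, v> = E <Z, v>. *)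
Definition is_mean (K : vspace R) (Z : Omega -> K) (m : K) : Prop :=
  vmem m /\ forall v : K, vmem v ->
    P.-integrable setT (fun w => (vip (Z w) v)%:E) /\
    vip m v = Ex (fun w => vip (Z w) v).

Definition is_cov (F G : lmodType R) (ipF : F -> F -> R) (ipG : G -> G -> R)
  (U : Omega -> G) (W : Omega -> F) (C : F -> G) : Prop :=
  exists (mU : G) (mW : F),
    [/\ is_mean (K := hspace ipG) U mU, is_mean (K := hspace ipF) W mW &
        is_mean (K := HSspace ipF ipG) (fun w => tens ipF (U w - mU) (W w - mW)) C].

Definition bounded_affine (H : vspace R) (K : vspace R) (gam : H -> K) : Prop :=
  exists (k0 : K) (L : H -> K),
    [/\ vmem k0, (forall (a : R) x y, L (a *: x + y) = a *: L x + L y),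
        (forall h, vmem (L h)),
        (exists c : R, forall h, nrm2 (@vip R K) (L h) <= c * nrm2 (@vip R H) h) &
        (forall h, gam h = k0 + L h)].

Definition in_aff_closure (H K : vspace R) (V : Omega -> H) (Y : Omega -> K) : Prop :=
  L2 Y /\ forall e : R, 0 < e -> exists gam : H -> K,
     bounded_affine gam /\ Ex (fun w => nrm2 (@vip R K) (Y w - gam (V w))) < e.

(* Y is (a version of) E^A[Z | V], the orthogonal projection of Z onto the
   closure above. *)
Definition is_lin_condexp (H K : vspace R) (V : Omega -> H) (Z : Omega -> K)
  (Y : Omega -> K) : Prop :=
  in_aff_closure V Y /\
  forall gam : H -> K, bounded_affine gam ->
    Ex (fun w => vip (Z w - Y w) (gam (V w))) = 0.

(* sigma(V): generated by the continuous linear functionals of V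
   (= preimages of the Borel sets of the separable Hilbert space H) *)
Definition sigmaV (H : lmodType R) (ipH : H -> H -> R) (V : Omega -> H) : set (set Omega) :=
  <<s [set A | exists (h : H) (B : set R), measurable B /\
               A = (fun w => ipH (V w) h) @^-1` B] >>.

Definition is_condexp (H G : lmodType R) (ipH : H -> H -> R) (ipG : G -> G -> R)
  (V : Omega -> H) (U : Omega -> G) (Y : Omega -> G) : Prop :=
  [/\ L2 (K := hspace ipG) Y,
      (forall (g : G) (B : set R), measurable B ->
          sigmaV ipH V ((fun w => ipG (Y w) g) @^-1` B)) &
      (forall (g : G) (A : set Omega), sigmaV ipH V A ->
          (\int[P]_(w in A) (ipG (Y w) g)%:E = \int[P]_(w in A) (ipG (U w) g)%:E)%E)].
End Prob.

Definition loewner_le (R : realType) (G : lmodType R) (ipG : G -> G -> R)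
  (A B : G -> G) : Prop := forall g : G, 0 <= ipG (B g - A g) g.

(* Main.v *)
Require Import Defs.
From HB Require Import structures.
From mathcomp Require Import all_boot all_order all_algebra.
From mathcomp Require Import all_classical all_reals all_analysis.
From mathcomp Require Import measurable_realfun ring lra.
Import Order.TTheory GRing.Theory Num.Theory.
Import numFieldNormedType.Exports HBNNSimple.
Local Open Scope classical_set_scope.
Local Open Scope ring_scope.

(* Pairing a Hilbert-Schmidt operator with g (x) f gives <A f, g>, so every weak
   identity reduces to the scalar variables u = <U, g>, w = <W, f> and their
   projections yu, yw.  Testing the projections against rank-one affine maps
   shows that u - yu is orthogonal to all c + <V, h>.  By Riesz's theorem these
   functions exhaust the scalarized affine functions of V, so u - yu is also
   orthogonal to their L^2 limits, in particular to 1, yu and yw.  Expanding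
   (u - a)(w - b) gives the covariance identity; the constant operators among
   the affine maps give the mean of Cov^A.  The Loewner inequalities are the
   same expansion for u - E[u|V] and E[u|V] - yu, since E[u|V] is a projection
   onto a larger space containing the affine functions of V. *)

(** * Inner product spaces: Cauchy-Schwarz and Riesz representation *)

Lemma quadratic_ge0_discr (R : realFieldType) (a b q : R) :
  0 <= q -> (forall t, 0 <= a + 2 * t * b + t ^+ 2 * q) -> b ^+ 2 <= a * q.
Proof.
rewrite le_eqVlt => /predU1P[<-|q0] H.
  have [->|b0] := eqVneq b 0; first by rewrite expr0n mulr0.
  (* With [q = 0] the expression is affine in [t]; this [t] gives it the value -1. *)
  have := H (- (a + 1) / (2 * b)).
  have -> : a + 2 * (- (a + 1) / (2 * b)) * b + (- (a + 1) / (2 * b)) ^+ 2 * 0 = -1.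
    by field.
  lra.
(* The vertex of the parabola. *)
have := H (- b / q).
have -> : a + 2 * (- b / q) * b + (- b / q) ^+ 2 * q = (a * q - b ^+ 2) / q.
  by field; rewrite gt_eqF.
by rewrite pmulr_lge0 ?invr_gt0// subr_ge0.
Qed.

Section InnerProduct.
Context {R : realType} {V : lmodType R} {ip : V -> V -> R}.
Hypothesis hV : is_separable_hilbert ip.

Lemma ipC x y : ip x y = ip y x.
Proof. by case: hV. Qed.

Lemma ipPl a x y z : ip (a *: x + y) z = a * ip x z + ip y z.
Proof. by case: hV. Qed.

Lemma ip_ge0 x : 0 <= ip x x.
Proof. by case: hV => _ _ []. Qed.

Lemma ip_eq0 x : ip x x = 0 -> x = 0.
Proof. by case: hV => _ _ [_ h] _ _; exact: h. Qed.

Lemma ipDl x y z : ip (x + y) z = ip x z + ip y z.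
Proof. by rewrite -[x]scale1r ipPl mul1r scale1r. Qed.

Lemma ip0l z : ip 0 z = 0.
Proof. by apply: (addrI (ip 0 z)); rewrite -ipDl !addr0. Qed.

Lemma ipZl a x z : ip (a *: x) z = a * ip x z.
Proof. by rewrite -[a *: x]addr0 ipPl ip0l addr0. Qed.

Lemma ipNl x z : ip (- x) z = - ip x z.
Proof. by rewrite -scaleN1r ipZl mulN1r. Qed.

Lemma ipBl x y z : ip (x - y) z = ip x z - ip y z.
Proof. by rewrite ipDl ipNl. Qed.

Lemma ip_suml (I : finType) (f : I -> V) z :
  ip (\sum_i f i) z = \sum_i ip (f i) z.
Proof. exact: (big_morph (ip ^~ z) (fun x y => ipDl x y z) (ip0l z)). Qed.

Lemma ipDr x y z : ip z (x + y) = ip z x + ip z y.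
Proof. by rewrite !(ipC z) ipDl. Qed.

Lemma ip0r z : ip z 0 = 0.
Proof. by rewrite ipC ip0l. Qed.

Lemma ipZr a x z : ip z (a *: x) = a * ip z x.
Proof. by rewrite !(ipC z) ipZl. Qed.

Lemma ipNr x z : ip z (- x) = - ip z x.
Proof. by rewrite !(ipC z) ipNl. Qed.

Lemma ip_inj x y : (forall z, ip x z = ip y z) -> x = y.
Proof.
by move=> xy; apply/subr0_eq/ip_eq0; rewrite ipBl xy subrr.
Qed.

Lemma cauchy_schwarz x y : ip x y ^+ 2 <= ip x x * ip y y.
Proof.
apply: quadratic_ge0_discr; first exact: ip_ge0.
move=> t; have := ip_ge0 (x + t *: y).
rewrite !(ipDl, ipDr, ipZl, ipZr) (ipC y x).
by congr (_ <= _); ring.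
Qed.

Lemma nrm2D_le x y : nrm2 ip (x + y) <= 2 * (nrm2 ip x + nrm2 ip y).
Proof.
have := ip_ge0 (x - y); rewrite /nrm2 !(ipDl, ipDr, ipNl, ipNr) (ipC y x).
lra.
Qed.

Lemma nrm2N x : nrm2 ip (- x) = nrm2 ip x.
Proof. by rewrite /nrm2 ipNl ipNr opprK. Qed.

(* The representative is the minimizer of |x|^2 - 2 l x; minimizing sequences
   are Cauchy by the parallelogram identity. *)
Lemma riesz (l : V -> R) (c : R) :
  (forall a x y, l (a *: x + y) = a * l x + l y) ->
  (forall x, l x ^+ 2 <= c * ip x x) ->
  exists h, forall x, l x = ip x h.
Proof.
move=> lP lc.
have l0 : l 0 = 0.
  by have := lP 1 0 0; rewrite scale1r addr0; lra.
have lZ a x : l (a *: x) = a * l x by rewrite -[a *: x]addr0 lP l0 addr0.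
have lD x y : l (x + y) = l x + l y by rewrite -[x]scale1r lP mul1r scale1r.
pose phi x := ip x x - 2 * l x.
pose c' := Num.max c 1.
have c'0 : 0 < c' by rewrite lt_max ltr01 orbT.
have lc' x : l x ^+ 2 <= c' * ip x x.
  by apply: (le_trans (lc x)); rewrite ler_wpM2r ?ip_ge0// le_max lexx.
(* Completing the square: multiplied by [c'], this is [(l x - c')^2 >= 0] combined with [lc'].
   Taking the maximum with 1 makes the factor positive. *)
have phi_lb x : - c' <= phi x.
  rewrite -(ler_pM2l c'0) /phi.
  have := lc' x; have := sqr_ge0 (l x - c'); nra.
pose E := range phi.
have hE : has_inf E.
  by split; [exists (phi 0), 0|exists (- c') => _ [x _ <-]].
pose m := inf E.
have phi_m x : m <= phi x by apply: ge_inf; [case: hE|exists x].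
have [u hu] : {u : nat -> V | forall n, phi (u n) < m + n.+1%:R^-1}.
  have /choice[u hu] : forall n, exists x, phi x < m + n.+1%:R^-1.
    move=> n; have [_ [x _ <-] hx] := @inf_adherent _ E n.+1%:R^-1 ltac:(by rewrite invr_gt0) hE.
    by exists x.
  by exists u.
have hu_e e : 0 < e -> exists N : nat, forall n, (N <= n)%N -> phi (u n) < m + e.
  move=> e0; exists (Num.truncn e^-1).+1 => n Nn; apply: (lt_le_trans (hu n)).
  rewrite lerD2l invf_ple ?posrE// ltW//.
  apply: (lt_le_trans (truncnS_gt _)); rewrite ler_nat.
  exact: leq_trans Nn _.
(* Parallelogram law: at the midpoint [phi] is the average of [phi a] and [phi b] minus a quarter of
   [nrm2 ip (a - b)], and it is at least [m]. *)
have phi_mid a b : nrm2 ip (a - b) <= 2 * (phi a - m + (phi b - m)).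
  have := phi_m (2^-1 *: (a + b)).
  rewrite /phi /nrm2 !(lZ, lD, ipDl, ipDr, ipZl, ipZr, ipNl, ipNr) (ipC b a).
  lra.
have [h hh] : exists h : V, forall e : R, 0 < e -> exists N : nat, forall n : nat,
              (N <= n)%N -> nrm2 ip (u n - h) < e.
  case: hV => _ _ _ cpl _; apply: cpl => e e0.
  have [N hN] := hu_e (e / 4) ltac:(lra).
  exists N => p q Np Nq; apply: (le_lt_trans (phi_mid _ _)).
  have := hN _ Np; have := hN _ Nq; lra.
exists h => x.
(* [phi (u n + t *: x) >= m] for all [t] is a quadratic inequality in [t]; its discriminant bounds
   how far [u n] is from satisfying the Euler equation [ip (u n) x = l x]. *)
have key n : (ip (u n) x - l x) ^+ 2 <= (phi (u n) - m) * ip x x.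
  apply: quadratic_ge0_discr; first exact: ip_ge0.
  move=> t; have := phi_m (u n + t *: x).
  rewrite /phi !(lZ, lD, ipDl, ipDr, ipZl, ipZr) (ipC x (u n)).
  by rewrite -subr_ge0; congr (_ <= _); ring.
suff : (l x - ip x h) ^+ 2 <= 0.
  by move=> H; apply/subr0_eq/eqP; rewrite -sqrf_eq0 eq_le H sqr_ge0.
apply/ler_addgt0Pr => e e0; rewrite add0r.
(* The factor 4 comes from [(p + q)^2 <= 2 p^2 + 2 q^2], each square being at most [e' * ip x x];
   the added 1 avoids division by zero. *)
pose e' := e / (4 * (ip x x + 1)).
have q0 : 0 <= ip x x := ip_ge0 x.
have e'0 : 0 < e' by apply: divr_gt0 => //; lra.
have ee' : e = 4 * (ip x x + 1) * e'.
  by rewrite /e' [RHS]mulrC divfK// gt_eqF//; lra.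
have [N1 /(_ (maxn N1 _) (leq_maxl _ _)) h1] := hu_e _ e'0.
have [N2 /(_ (maxn N1 N2) (leq_maxr _ _)) h2] := hh _ e'0.
have {}h1 := h1 N2.
have k1 := key (maxn N1 N2).
have k2 := cauchy_schwarz (u (maxn N1 N2) - h) x.
set un := u _ in h1 h2 k1 k2.
have k1' : (ip un x - l x) ^+ 2 <= e' * ip x x.
  by apply: (le_trans k1); rewrite ler_wpM2r//; lra.
have k2' : ip (un - h) x ^+ 2 <= e' * ip x x.
  by apply: (le_trans k2); rewrite ler_wpM2r// ltW.
move: k2'; rewrite ipBl (ipC h x) => k2'.
have := sqr_ge0 ((ip un x - l x) + (ip un x - ip x h)).
rewrite ee'; nra.
Qed.

End InnerProduct.

(** * Hilbert-Schmidt norm under rank-one perturbations *)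

Section HilbertSchmidt.
Context {R : realType} {F G : lmodType R}.
Context {ipF : F -> F -> R} {ipG : G -> G -> R}.
Hypotheses (hF : is_separable_hilbert ipF) (hG : is_separable_hilbert ipG).

Local Notation hs := (hs_norm2 ipF ipG).

Lemma linear_map0 (A : F -> G) : is_linear_map A -> A 0 = 0.
Proof.
move=> lA; apply: (addrI (A 0)); rewrite addr0.
by have := lA 1 0 0; rewrite !scale1r addr0.
Qed.

Lemma linear_mapZ (A : F -> G) a x : is_linear_map A -> A (a *: x) = a *: A x.
Proof. by move=> lA; rewrite -[a *: x]addr0 lA linear_map0// addr0. Qed.

Lemma linear_map_sum (A : F -> G) (I : finType) (f : I -> F) :
  is_linear_map A -> A (\sum_i f i) = \sum_i A (f i).
Proof.
move=> lA; apply: (big_morph A) => [x y|]; last exact: linear_map0.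
by rewrite -[x]scale1r lA !scale1r.
Qed.

Lemma tens_linear (g : G) (f : F) : is_linear_map (tens ipF g f).
Proof. by move=> a x y; rewrite /tens (ipDr hF) (ipZr hF) scalerDl scalerA. Qed.

Lemma linear_mapD (A B : F -> G) :
  is_linear_map A -> is_linear_map B -> is_linear_map (A + B).
Proof.
move=> lA lB a x y; change (A (a *: x + y) + B (a *: x + y) =
  a *: (A x + B x) + (A y + B y)).
by rewrite lA lB scalerDr addrACA.
Qed.

Lemma linear_mapN (A : F -> G) : is_linear_map A -> is_linear_map (- A).
Proof.
move=> lA a x y; change (- A (a *: x + y) = a *: - A x + - A y).
by rewrite lA opprD scalerN.
Qed.

Lemma hs_norm2_ge0 A : (0 <= hs A)%E.
Proof.
(* The empty family contributes the value 0. *)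
apply: ereal_sup_ubound; exists 0%N, (fun=> 0); split; first by case.
by rewrite big_ord0.
Qed.

Lemma is_HS_fin A : is_HS ipF ipG A -> hs A = (fine (hs A))%:E.
Proof. by case=> _ Aoo; rewrite fineK// ge0_fin_numE// hs_norm2_ge0. Qed.

(** One Gram-Schmidt step: the normalized residual of [f] is adjoined unless it vanishes. To bound
    [hs_norm2] it thus suffices to bound the sums over families whose span contains [f]. *)
Lemma orthonormal_extend n (e : 'I_n -> F) f : Defs.orthonormal ipF e ->
  exists m (e' : 'I_m -> F), [/\ Defs.orthonormal ipF e',
    f = \sum_i ipF f (e' i) *: e' i &
    forall A : F -> G, \sum_i ipG (A (e i)) (A (e i)) <=
                       \sum_i ipG (A (e' i)) (A (e' i))].
Proof.
move=> oe; pose q := f - \sum_i ipF f (e i) *: e i.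
have qe i : ipF q (e i) = 0.
  rewrite (ipBl hF) (ip_suml hF) (bigD1 i)//= (ipZl hF) oe eqxx mulr1.
  rewrite big1 ?addr0 ?subrr// => j ji.
  by rewrite (ipZl hF) oe (negbTE ji) mulr0.
have [q0|q0] := eqVneq (ipF q q) 0.
  by exists n, e; split => //; apply/subr0_eq; exact: ip_eq0 hF _ q0.
have qp : 0 < ipF q q by rewrite lt_neqAle eq_sym q0 (ip_ge0 hF).
pose s := Num.sqrt (ipF q q).
have s0 : s != 0 by rewrite gt_eqF// sqrtr_gt0.
have ss : ipF q q = s * s by rewrite -expr2 sqr_sqrtr// ltW.
pose e' (i : 'I_n.+1) := if unlift ord0 i is Some j then e j else s^-1 *: q.
have e'0 : e' ord0 = s^-1 *: q by rewrite /e' unlift_none.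
have e'S i : e' (lift ord0 i) = e i by rewrite /e' liftK.
exists n.+1, e'; split.
- move=> i j; case: (unliftP ord0 i) => [i'|] ->; case: (unliftP ord0 j) => [j'|] ->.
  + by rewrite !e'S oe (inj_eq lift_inj).
  + by rewrite e'S e'0 (ipZr hF) (ipC hF) qe mulr0.
  + by rewrite e'S e'0 (ipZl hF) qe mulr0.
  + by rewrite e'0 (ipZl hF) (ipZr hF) eqxx ss mulKf// mulVf.
- rewrite big_ord_recl e'0; under eq_bigr do rewrite e'S.
  have -> : ipF f (s^-1 *: q) = s.
    have -> : f = q + \sum_i ipF f (e i) *: e i by rewrite subrK.
    rewrite (ipDl hF) !(ipZr hF) (ip_suml hF) big1 => [|i _].
      by rewrite mulr0 addr0 ss mulKf.
    by rewrite (ipZl hF) [ipF (e i) q](ipC hF) qe mulr0.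
  by rewrite scalerA mulfV// scale1r subrK.
- move=> A; rewrite big_ord_recl.
  under [X in _ <= _ + X]eq_bigr do rewrite e'S.
  by rewrite lerDr (ip_ge0 hG).
Qed.

(** On a family whose span contains [f], Parseval turns the cross term and the square term into
    exactly [ipG (A f) g] and [ipF f f * ipG g g]; the supremum inherits the bound. *)
Lemma hs_tens_le A f g (a : R) : is_linear_map A -> (hs A <= a%:E)%E ->
  (hs (A + tens ipF g f)%R <= (a + 2 * ipG (A f) g + ipF f f * ipG g g)%:E)%E.
Proof.
move=> lA Aa; apply: ge_ereal_sup => _ [n [e [/orthonormal_extend oe ->]]].
have [m [e' [oe' fe' le']]] := oe f.
rewrite lee_fin; apply: (le_trans (le' _)).
have -> : \sum_i ipG ((A + tens ipF g f) (e' i)) ((A + tens ipF g f) (e' i)) =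
    \sum_i ipG (A (e' i)) (A (e' i)) + 2 * ipG (A f) g + ipF f f * ipG g g.
  have -> : ipG (A f) g = \sum_i ipF f (e' i) * ipG (A (e' i)) g.
    rewrite {1}fe' linear_map_sum// (ip_suml hG).
    by apply: eq_bigr => i _; rewrite linear_mapZ// (ipZl hG).
  have -> : ipF f f = \sum_i ipF f (e' i) * ipF f (e' i).
    rewrite {1}fe' (ip_suml hF).
    by apply: eq_bigr => i _; rewrite (ipZl hF) [ipF (e' i) f](ipC hF).
  rewrite mulr_sumr mulr_suml -!big_split/=; apply: eq_bigr => i _.
  change ((A + tens ipF g f) (e' i)) with (A (e' i) + ipF f (e' i) *: g).
  rewrite !(ipDl hG, ipDr hG, ipZl hG, ipZr hG) (ipC hG g); ring.
rewrite !lerD2r -lee_fin; apply: le_trans Aa.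
by apply: ereal_sup_ubound; exists m, e'.
Qed.

Lemma tensNl (g : G) (f : F) : tens ipF (- g) f = - tens ipF g f.
Proof. by apply/funext => x; exact: scalerN. Qed.

(** The upper bound is its own converse: adding [tens ipF (- g) f] to [A + tens ipF g f] gives back
    [A], and bounding that step yields the opposite inequality. *)
Lemma hs_tens A f g : is_HS ipF ipG A ->
  hs (A + tens ipF g f) =
  (fine (hs A) + 2 * ipG (A f) g + ipF f f * ipG g g)%:E.
Proof.
move=> hA; have [lA _] := hA.
have lB := linear_mapD _ _ lA (tens_linear g f).
have le1 : (hs (A + tens ipF g f)%R <=
    (fine (hs A) + 2 * ipG (A f) g + ipF f f * ipG g g)%:E)%E.
  by apply: hs_tens_le => //; rewrite -is_HS_fin.
have hB : is_HS ipF ipG (A + tens ipF g f).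
  by split => //; apply: (le_lt_trans le1); exact: ltry.
apply/eqP; rewrite eq_le le1/=.
have := @hs_tens_le (A + tens ipF g f) f (- g) (fine (hs (A + tens ipF g f))) lB.
rewrite -is_HS_fin// => /(_ (lexx _)).
rewrite tensNl addrK (is_HS_fin _ hA) (is_HS_fin _ hB) !lee_fin.
change ((A + tens ipF g f) f) with (A f + ipF f f *: g).
rewrite !(ipDl hG, ipDr hG, ipZl hG, ipZr hG, ipNr hG, ipNl hG) /=.
lra.
Qed.

Lemma is_HS0 : is_HS ipF ipG 0.
Proof.
split; first by move=> a x y; change (0 = a *: (0 : G) + 0); rewrite scaler0 addr0.
apply: (@le_lt_trans _ _ 0%E); last exact: ltry.
apply: ge_ereal_sup => _ [n [e [_ ->]]].
by rewrite big1// => i _; rewrite (ip0l hG).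
Qed.

Lemma is_HSD_tens A f g : is_HS ipF ipG A -> is_HS ipF ipG (A + tens ipF g f).
Proof.
move=> hA; split; last by rewrite hs_tens//; exact: ltry.
by apply: linear_mapD; [case: hA|exact: tens_linear].
Qed.

Lemma is_HS_tens f g : is_HS ipF ipG (tens ipF g f).
Proof. by rewrite -[tens _ _ _]add0r; exact: is_HSD_tens is_HS0. Qed.

Lemma is_HSB A B : is_HS ipF ipG A -> is_HS ipF ipG B -> is_HS ipF ipG (A - B).
Proof.
move=> hA hB; split.
  by apply: linear_mapD; [case: hA|apply: linear_mapN; case: hB].
apply: (@le_lt_trans _ _ (2 * (fine (hs A) + fine (hs B)))%:E); last exact: ltry.
apply: ge_ereal_sup => _ [n [e [oe ->]]]; rewrite lee_fin.
apply: (@le_trans _ _ (\sum_i (2 * (ipG (A (e i)) (A (e i)) + ipG (B (e i)) (B (e i)))))).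
  apply: ler_sum => i _; rewrite -[ipG (B _) _](nrm2N hG).
  exact: (nrm2D_le hG).
rewrite -mulr_sumr big_split/= ler_wpM2l// lerD//.
  by rewrite -lee_fin -is_HS_fin//; apply: ereal_sup_ubound; exists n, e.
by rewrite -lee_fin -is_HS_fin//; apply: ereal_sup_ubound; exists n, e.
Qed.

(* Elementary tensors separate Hilbert-Schmidt operators: every weak identity
   in the Hilbert-Schmidt space reduces to scalar ones through this formula. *)
Lemma ip_HS_tens A f g : is_HS ipF ipG A ->
  ip_HS ipF ipG A (tens ipF g f) = ipG (A f) g.
Proof.
move=> hA; rewrite /ip_HS -tensNl !hs_tens//= !(ipNl hG, ipNr hG).
by field.
Qed.

End HilbertSchmidt.

(** * Square-integrable scalar variables: decompositions and limits of orthogonality relations *)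

Section SquareIntegrable.
Context {R : realType} {d : measure_display} {Omega : measurableType d}.
Variable P : probability Omega R.
Implicit Types f g h u r y z : Omega -> R.

Local Notation intg f := (P.-integrable setT (EFin \o f)).
Local Notation E := (Ex P).

Definition sqint f := measurable_fun setT f /\ intg (fun w => f w ^+ 2).

Lemma ExD f g : intg f -> intg g -> E (fun w => f w + g w) = E f + E g.
Proof. exact: RintegralD. Qed.

Lemma ExB f g : intg f -> intg g -> E (fun w => f w - g w) = E f - E g.
Proof. exact: RintegralB. Qed.

Lemma ExZ a f : intg f -> E (fun w => a * f w) = a * E f.
Proof. exact: RintegralZl. Qed.

Lemma intgD f g : intg f -> intg g -> intg (fun w => f w + g w).
Proof. by move=> hf hg; exact: integrableD hf hg. Qed.

Lemma intgZ a f : intg f -> intg (fun w => a * f w).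
Proof. by move=> hf; exact: integrableZl hf. Qed.

Lemma intg_cst a : intg (fun=> a).
Proof. exact: finite_measure_integrable_cst. Qed.

Lemma intg_le f g : measurable_fun setT f -> (forall w, `|f w| <= g w) ->
  intg g -> intg f.
Proof.
move=> mf fg; apply: le_integrable => //; first exact/measurable_EFinP.
move=> w _ /=; rewrite lee_fin; apply: (le_trans (fg w)); exact: ler_norm.
Qed.

Lemma le_Ex f g : intg f -> intg g -> (forall w, f w <= g w) -> E f <= E g.
Proof. by move=> hf hg fg; apply: le_Rintegral. Qed.

Lemma Ex_ge0 f : (forall w, 0 <= f w) -> 0 <= E f.
Proof. by move=> f0; apply: Rintegral_ge0. Qed.

(* Holds although [g] need not be measurable: the integral of a nonnegative
   function is a supremum over the simple functions below it. *)
Lemma le_Ex_nonmeasurable f g h : (forall w, 0 <= f w <= g w) ->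
  (forall w, g w <= h w) -> intg h -> E f <= E g.
Proof.
move=> fg gh ih.
have le_int (f1 f2 : Omega -> R) : (forall w, 0 <= f1 w <= f2 w) ->
    (\int[P]_(w in setT) (f1 w)%:E <= \int[P]_(w in setT) (f2 w)%:E)%E.
  move=> f12.
  have f1_0 w : (0 <= (f1 w)%:E)%E by rewrite lee_fin; case/andP: (f12 w).
  have f2_0 w : (0 <= (f2 w)%:E)%E.
    by rewrite (le_trans (f1_0 w))// lee_fin; case/andP: (f12 w).
  rewrite (ge0_integralTE P f1_0) (ge0_integralTE P f2_0).
  apply: le_ereal_sup => _ [s /= sf <-]; exists s => // w.
  by apply: (le_trans (sf w)); rewrite lee_fin; case/andP: (f12 w).
have g0 w : 0 <= g w by case/andP: (fg w); exact: le_trans.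
have ghoo : (\int[P]_(w in setT) (g w)%:E < +oo)%E.
  apply: (@le_lt_trans _ _ (\int[P]_(w in setT) (h w)%:E)%E).
    by apply: le_int => w; rewrite g0 gh.
  exact: integrable_lty.
have gfin : (\int[P]_(w in setT) (g w)%:E)%E \is a fin_num.
  by rewrite ge0_fin_numE//; apply: integral_ge0 => w _; rewrite lee_fin.
have ffin : (\int[P]_(w in setT) (f w)%:E)%E \is a fin_num.
  rewrite ge0_fin_numE; first exact: le_lt_trans (le_int _ _ fg) ghoo.
  by apply: integral_ge0 => w _; rewrite lee_fin; case/andP: (fg w).
by rewrite /Ex /Rintegral fine_le//; exact: le_int.
Qed.

Lemma sqint_mul f g : sqint f -> sqint g -> intg (fun w => f w * g w).
Proof.
move=> [mf f2] [mg g2].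
apply: (intg_le _ (fun w => f w ^+ 2 + g w ^+ 2)).
- exact: measurable_funM.
- move=> w; rewrite normrM -(real_normK (num_real (f w))) -(real_normK (num_real (g w))).
  have := sqr_ge0 (`|f w| - `|g w|); have := sqr_ge0 (`|f w| + `|g w|); nra.
- exact: intgD.
Qed.

Lemma sqintZ a f : sqint f -> sqint (fun w => a * f w).
Proof.
move=> [mf f2]; split; first exact: measurable_funM.
rewrite (_ : (fun w => _) = (fun w => a ^+ 2 * f w ^+ 2)); first exact: intgZ.
by apply/funext => w; rewrite exprMn.
Qed.

Lemma sqintD f g : sqint f -> sqint g -> sqint (fun w => f w + g w).
Proof.
move=> hf hg; split; first by apply: measurable_funD; [case: hf|case: hg].
rewrite (_ : (fun w => _) = (fun w => f w ^+ 2 + 2 * (f w * g w) + g w ^+ 2)).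
  by apply: intgD; [apply: intgD; [case: hf|apply: intgZ; exact: sqint_mul]|case: hg].
by apply/funext => w; ring.
Qed.

Lemma sqintB f g : sqint f -> sqint g -> sqint (fun w => f w - g w).
Proof.
move=> hf hg; rewrite (_ : (fun w => _) = (fun w => f w + (-1) * g w)).
  by apply: sqintD => //; exact: sqintZ.
by apply/funext => w; ring.
Qed.

Lemma sqint_cst a : sqint (fun=> a).
Proof. by split; [exact: measurable_cst|exact: intg_cst]. Qed.

Lemma sqint_intg f : sqint f -> intg f.
Proof.
move=> hf; have := sqint_mul _ _ hf (sqint_cst 1).
by under eq_fun do rewrite mulr1.
Qed.

(** Splitting [u] and [w] into projection and residual leaves two cross terms and multiples of the
    residual means, all zero. The centres [a], [b] are arbitrary because the residuals have mean
    zero. *)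
Lemma cov_decomp u (w yu yw : Omega -> R) (a b : R) :
  sqint u -> sqint w -> sqint yu -> sqint yw ->
  E (fun o => u o - yu o) = 0 -> E (fun o => w o - yw o) = 0 ->
  E (fun o => (u o - yu o) * yw o) = 0 -> E (fun o => (w o - yw o) * yu o) = 0 ->
  E (fun o => (u o - a) * (w o - b)) =
  E (fun o => (yu o - a) * (yw o - b)) + E (fun o => (u o - yu o) * (w o - yw o)).
Proof.
move=> hu hw hyu hyw ru rw ruw rwu.
have hru := sqintB _ _ hu hyu; have hrw := sqintB _ _ hw hyw.
have -> : (fun o => (u o - a) * (w o - b)) =
  (fun o => ((yu o - a) * (yw o - b) + (u o - yu o) * (w o - yw o)) +
    (((u o - yu o) * yw o + (w o - yw o) * yu o) +
    ((- b) * (u o - yu o) + (- a) * (w o - yw o)))).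
  by apply/funext => o; ring.
have i1 : intg (fun o => (yu o - a) * (yw o - b)).
  by apply: sqint_mul; apply: sqintB => //; exact: sqint_cst.
have i2 := sqint_mul _ _ hru hrw.
have i3 := sqint_mul _ _ hru hyw.
have i4 := sqint_mul _ _ hrw hyu.
have i5 := intgZ (- b) _ (sqint_intg _ hru).
have i6 := intgZ (- a) _ (sqint_intg _ hrw).
have i12 := intgD _ _ i1 i2; have i34 := intgD _ _ i3 i4.
have i56 := intgD _ _ i5 i6; have i3456 := intgD _ _ i34 i56.
rewrite (ExD _ _ i12 i3456) (ExD _ _ i1 i2) (ExD _ _ i34 i56) (ExD _ _ i3 i4).
rewrite (ExD _ _ i5 i6) (ExZ _ _ (sqint_intg _ hru)) (ExZ _ _ (sqint_intg _ hrw)).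
by rewrite ru rw ruw rwu !mulr0 !addr0.
Qed.

Lemma var_le u y (a : R) : sqint u -> sqint y ->
  E (fun o => u o - y o) = 0 -> E (fun o => (u o - y o) * y o) = 0 ->
  E (fun o => (y o - a) * (y o - a)) <= E (fun o => (u o - a) * (u o - a)).
Proof.
move=> hu hy uy0 uyy0; rewrite (cov_decomp u u y y)// lerDl.
by apply: Ex_ge0 => o; rewrite -expr2 sqr_ge0.
Qed.

(** Pairing with [r] is L^2-continuous; instead of Cauchy-Schwarz for expectations, a pointwise
    weighted Young inequality is integrated. *)
Lemma Ex_mul_closure r y : sqint r -> sqint y ->
  (forall e, 0 < e -> exists z, [/\ sqint z, E (fun w => r w * z w) = 0 &
     E (fun w => (y w - z w) ^+ 2) < e]) ->
  E (fun w => r w * y w) = 0.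
Proof.
move=> hr hy H; apply/normr0_eq0/eqP; rewrite eq_le normr_ge0 andbT.
apply/ler_addgt0Pr => e e0; rewrite add0r.
set S := E (fun w => r w ^+ 2).
have S0 : 0 <= S by apply: Ex_ge0 => w; exact: sqr_ge0.
(* Young with weight [t] bounds the error by half of [t * S + E (y - z)^2 / t]; choosing [z] within
   [t ^+ 2] makes this at most [t * (S + 1) / 2], below [e]. *)
pose t := e / (S + 1).
have t0 : 0 < t by apply: divr_gt0 => //; lra.
have et : e = t * (S + 1) by rewrite /t divfK// gt_eqF//; lra.
have [z [hz rz0 yz]] := H _ (exprn_gt0 2 t0).
have hyz := sqintB _ _ hy hz.
have -> : E (fun w => r w * y w) = E (fun w => r w * (y w - z w)).
  rewrite -[LHS]subr0 -rz0 -ExB; [|exact: sqint_mul..].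
  by congr (E _); apply/funext => w; ring.
apply: (le_trans (le_normr_Rintegral _ (sqint_mul _ _ hr hyz))) => //.
apply: (@le_trans _ _ (E (fun w => 2^-1 * t * r w ^+ 2 + 2^-1 * t^-1 * (y w - z w) ^+ 2))).
  apply: le_Ex; first by apply: integrable_norm; exact: sqint_mul.
    by apply: intgD; apply: intgZ; [case: hr|case: hyz].
  move=> w /=; rewrite normrM -(real_normK (num_real (r w))).
  rewrite -(real_normK (num_real (y w - z w))).
  have tt : t * t^-1 = 1 by rewrite mulfV// gt_eqF.
  rewrite -(ler_pM2l t0).
  have -> : t * (2^-1 * t * `|r w| ^+ 2 + 2^-1 * t^-1 * `|y w - z w| ^+ 2) =
      2^-1 * (t * `|r w|) ^+ 2 + 2^-1 * (t * t^-1) * `|y w - z w| ^+ 2 by ring.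
  have := sqr_ge0 (t * `|r w| - `|y w - z w|).
  by rewrite tt; nra.
rewrite ExD ?ExZ; try by [case: hr|case: hyz|apply: intgZ; case: hr|apply: intgZ; case: hyz].
rewrite -/S.
have : t^-1 * E (fun w => (y w - z w) ^+ 2) <= t.
  by rewrite ler_pdivrMl// -expr2 ltW.
rewrite et -mulrA; nra.
Qed.

Lemma Ex_sum_eq0 n (F : 'I_n -> Omega -> R) :
  (forall i, intg (F i) /\ E (F i) = 0) ->
  intg (fun w => \sum_i F i w) /\ E (fun w => \sum_i F i w) = 0.
Proof.
elim: n F => [|n IH] F hF.
  under eq_fun do rewrite big_ord0.
  by split; [exact: intg_cst|rewrite /Ex Rintegral_cst// mul0r].
under eq_fun do rewrite big_ord_recl.
have [i0 e0] := hF ord0; have [i1 e1] := IH _ (fun i => hF (lift ord0 i)).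
by split; [exact: intgD|rewrite ExD// e0 e1 addr0].
Qed.

(** Simple functions approximate [h] on the real line rather than [h \o z] on [Omega], so their
    level sets pull back to preimages of Borel sets under [z], where the hypothesis applies.
    Dominated convergence uses the bound [|r z|]. *)
Lemma Ex_mul_comp_eq0 r z (h : R -> R) : sqint r -> sqint z ->
  (forall B : set R, measurable B -> E (fun w => r w * \1_(z @^-1` B) w) = 0) ->
  measurable_fun setT h -> (forall x, 0 <= h x <= `|x|) ->
  E (fun w => r w * h (z w)) = 0.
Proof.
move=> hr hz rz mh hx.
have mr : measurable_fun setT r by case: hr.
have mz : measurable_fun setT z by case: hz.
have mEh : measurable_fun setT (EFin \o h) by exact/measurable_EFinP.
pose s := nnsfun_approx measurableT mEh.
have s_cvg x : (s n x)%:E @[n --> \oo] --> (h x)%:E.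
  have Eh0 t : [set: R] t -> (0 <= (EFin \o h) t)%E.
    by rewrite /= lee_fin; case/andP: (hx t).
  exact: (cvg_nnsfun_approx measurableT mEh Eh0 (x := x) I).
have s_le n x : s n x <= h x.
  have nd : nondecreasing_seq (fun k => s k x).
    by move=> a b ab; exact/lefP/nd_nnsfun_approx.
  have /fine_cvgP[_ cv] := s_cvg x.
  have <- : limn (fun k => s k x) = h x by apply/cvg_lim.
  by apply: nondecreasing_cvgn_le => //; apply/cvg_ex; exists (h x).
have sn0 n : E (fun w => r w * s n (z w)) = 0.
  have -> : (fun w => r w * s n (z w)) = (fun w => \sum_(i < size (finmap.enum_fset (fset_set (range (s n)))))
     (r w * ((finmap.enum_fset (fset_set (range (s n))))`_i *
           \1_(z @^-1` (s n @^-1` [set (finmap.enum_fset (fset_set (range (s n))))`_i])) w))).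
    by apply/funext => w; rewrite [s n (z w)]fimfunEord mulr_sumr.
  apply: (Ex_sum_eq0 _ _ _).2 => i; set c := _`_i; set B := s n @^-1` _.
  have mB : measurable B by exact: measurable_funPTI.
  have -> : (fun w => r w * (c * \1_(z @^-1` B) w)) = (fun w => c * (r w * \1_(z @^-1` B) w)).
    by apply/funext => w; ring.
  have iB : intg (fun w => r w * \1_(z @^-1` B) w).
    apply: (intg_le _ (fun w => `|r w|)).
    - apply: measurable_funM => //; apply: measurable_indic.
      by rewrite -[X in measurable X]setTI; exact: mz.
    - move=> w; rewrite normrM ler_piMr// indicE.
      by case: (_ \in _); rewrite ?normr1 ?normr0.
    - by apply: integrable_norm; exact: sqint_intg.
  by split; [exact: intgZ|rewrite ExZ// rz// mulr0].
have ms n : measurable_fun setT (fun w => r w * s n (z w)).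
  apply: measurable_funM => //.
  by apply: measurableT_comp => //; exact: measurable_funP.
have hb n x : 0 <= s n x by exact: fun_ge0.
have [] := @dominated_convergence _ _ _ P setT measurableT
  (fun n w => (r w * s n (z w))%:E) (fun w => (r w * h (z w))%:E)
  (fun w => (`|r w * z w|)%:E).
- by move=> n; apply/measurable_EFinP; exact: ms.
- apply/measurable_EFinP/measurable_funM => //; exact: measurableT_comp.
- apply: aeW => w _; under eq_fun do rewrite EFinM; rewrite EFinM.
  by apply: cvgeZl.
- by apply: integrable_norm; exact: sqint_mul.
- apply: aeW => w n _; rewrite /= lee_fin !normrM ler_wpM2l//.
  rewrite ger0_norm//; apply: (le_trans (s_le n _)); by case/andP: (hx (z w)).
move=> ih _ cv.
(* [Ex] applies [fine], which also sends infinite values to 0, so finiteness is needed to conclude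
   that the extended integral vanishes. *)
have sn0' n : (\int[P]_(w in setT) (r w * s n (z w))%:E)%E = 0%E.
  rewrite -[LHS]fineK; first by congr EFin; exact: sn0.
  apply: integrable_fin_num => //.
  apply: (intg_le _ (fun w => `|r w * z w|)) => //.
  - move=> w; rewrite !normrM ler_wpM2l// ger0_norm//.
    by apply: (le_trans (s_le n _)); case/andP: (hx (z w)).
  - by apply: integrable_norm; exact: sqint_mul.
rewrite /Ex /Rintegral; move: cv; under eq_fun do rewrite sn0'.
by move=> /(cvg_unique (@ereal_hausdorff R) (cvg_cst _)) <-.
Qed.

(** [z] is split into positive and negative parts, each a function of [z] lying between 0 and
    [|z|]. *)
Lemma Ex_mul_eq0 r z : sqint r -> sqint z ->
  (forall B : set R, measurable B -> E (fun w => r w * \1_(z @^-1` B) w) = 0) ->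
  E (fun w => r w * z w) = 0.
Proof.
move=> hr hz rz.
have mm : measurable_fun setT (fun x : R => Num.max x 0).
  by apply: measurable_maxr => //; exact: measurable_cst.
have mn : measurable_fun setT (fun x : R => Num.max (- x) 0).
  by apply: measurable_maxr; [exact: measurable_funN|exact: measurable_cst].
have pB (x : R) : 0 <= Num.max x 0 <= `|x|.
  by rewrite le_max lexx orbT ge_max ler_norm normr_ge0.
have nB (x : R) : 0 <= Num.max (- x) 0 <= `|x|.
  by rewrite -normrN.
have mz : measurable_fun setT z by case: hz.
have hs (h : R -> R) : measurable_fun setT h -> (forall x, 0 <= h x <= `|x|) ->
    intg (fun w => r w * h (z w)).
  move=> mh hx; apply: (intg_le _ (fun w => `|r w * z w|)).
  - by apply: measurable_funM; [case: hr|exact: measurableT_comp mh mz].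
  - move=> w; case/andP: (hx (z w)) => h0 h1.
    by rewrite !normrM ler_wpM2l// ger0_norm.
  - by apply: integrable_norm; exact: sqint_mul.
have -> : (fun w => r w * z w) =
    (fun w => r w * Num.max (z w) 0 - r w * Num.max (- z w) 0).
  apply/funext => w; rewrite -mulrBr; congr (_ * _).
  by have [z0|z0] := leP 0 (z w); rewrite ?maxEle /=; case: ifP; lra.
rewrite ExB; [|exact: (hs _ mm pB)|exact: (hs _ mn nB)].
by rewrite (Ex_mul_comp_eq0 _ _ _ hr hz rz mm pB) (Ex_mul_comp_eq0 _ _ _ hr hz rz mn nB) subrr.
Qed.

End SquareIntegrable.

Lemma sqint_ip {R : realType} {d : measure_display} {Omega : measurableType d}
  {P : probability Omega R} {K : lmodType R} {ipK : K -> K -> R}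
  (hK : is_separable_hilbert ipK) (Z : Omega -> K) (v : K) : L2 P (K := hspace ipK) Z ->
  sqint P (fun o => ipK (Z o) v).
Proof.
move=> [_ mZ iZ]; have mv := mZ v I; split => //.
apply: (intg_le _ _ (fun o => ipK v v * ipK (Z o) (Z o))).
- exact: (measurable_funX 2 mv).
- by move=> o; rewrite ger0_norm ?sqr_ge0// mulrC; exact: (cauchy_schwarz hK).
- exact: intgZ iZ.
Qed.

(** * Affine functions of [V] and their scalarizations *)

Section LinearConditioning.
Context {R : realType} {d : measure_display} {Omega : measurableType d}.
Variable P : probability Omega R.
Context {H K : lmodType R} {ipH : H -> H -> R} {ipK : K -> K -> R}.
Hypotheses (hH : is_separable_hilbert ipH) (hK : is_separable_hilbert ipK).

Local Notation E := (Ex P).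

(** The functional [ipK (L x) g] of [x] has squared norm at most [c * ipK g g], so Riesz represents
    it. Scalarized affine maps thus have the form that rank-one maps test. *)
Lemma bounded_affine_riesz (gam : H -> K) (g : K) :
  bounded_affine (H := hspace ipH) (K := hspace ipK) gam ->
  exists c h, forall x, ipK (gam x) g = c + ipH x h.
Proof.
move=> [k0 [L [_ lL _ [c cL] gamE]]].
have [|x|h hh] := riesz hH (fun x => ipK (L x) g) (c * ipK g g).
- by move=> a x y; rewrite lL (ipPl hK).
- apply: (le_trans (cauchy_schwarz hK _ _)).
  by rewrite mulrAC ler_wpM2r ?(ip_ge0 hK)//; exact: cL.
by exists (ipK k0 g), h => x; rewrite gamE (ipDl hK) hh.
Qed.

Lemma bounded_affine_nrm2 (gam : H -> K) :
  bounded_affine (H := hspace ipH) (K := hspace ipK) gam ->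
  exists a b, forall x, nrm2 ipK (gam x) <= a + b * nrm2 ipH x.
Proof.
move=> [k0 [L [_ lL _ [c cL] gamE]]].
exists (2 * nrm2 ipK k0), (2 * c) => x; rewrite gamE.
apply: (le_trans (nrm2D_le hK _ _)).
by rewrite mulrDr lerD2l -mulrA ler_wpM2l//; exact: cL.
Qed.

Lemma bounded_affine_rank1 (c : R) (h : H) (k : K) :
  bounded_affine (H := hspace ipH) (K := hspace ipK)
    (fun x => (c + ipH x h) *: k).
Proof.
exists (c *: k), (fun x => ipH x h *: k); split => //.
- by move=> a x y; rewrite (ipPl hH) scalerDl scalerA.
- exists (ipH h h * ipK k k) => x; rewrite /nrm2 /= (ipZl hK) (ipZr hK) mulrA.
  rewrite [leRHS]mulrAC ler_wpM2r ?(ip_ge0 hK)// [leRHS]mulrC -expr2.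
  exact: (cauchy_schwarz hH).
- by move=> x; rewrite scalerDl.
Qed.

Variable V : Omega -> H.
Hypothesis hV : L2 P (K := hspace ipH) V.

Lemma sqint_affine c h : sqint P (fun o => c + ipH (V o) h).
Proof.
apply: sqintD; first exact: sqint_cst.
exact: sqint_ip hH _ _ hV.
Qed.

Lemma lin_condexp_orth (Z Y : Omega -> K) (c : R) (h : H) (k : K) :
  is_lin_condexp P (H := hspace ipH) (K := hspace ipK) V Z Y ->
  E (fun o => (ipK (Z o) k - ipK (Y o) k) * (c + ipH (V o) h)) = 0.
Proof.
move=> [_ /(_ _ (bounded_affine_rank1 c h k)) orth]; rewrite -[RHS]orth.
congr (Ex P _); apply/funext => o /=.
by rewrite (ipZr hK) (ipBl hK) mulrC.
Qed.

(** By Cauchy-Schwarz, pairing with [k] costs a factor [ipK k k] in squared distance; Riesz gives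
    the scalarized approximant its form. *)
Lemma aff_closure_approx (Y : Omega -> K) (k : K) (e : R) :
  in_aff_closure P (H := hspace ipH) (K := hspace ipK) V Y -> 0 < e ->
  exists c h, E (fun o => (ipK (Y o) k - (c + ipH (V o) h)) ^+ 2) < e.
Proof.
move=> [L2Y clY] e0.
(* The added 1 keeps the divisor positive when [k = 0]. *)
have kp : 0 < ipK k k + 1 by rewrite ltr_wpDl ?(ip_ge0 hK).
have [gam [gamA gamY]] := clY _ (divr_gt0 e0 kp).
have [c [h gamk]] := bounded_affine_riesz gam k gamA.
have [a [b gamn]] := bounded_affine_nrm2 gam gamA.
exists c, h.
set f := fun o => _.
have if_ : P.-integrable setT (EFin \o f).
  exact: (sqintB _ _ _ (sqint_ip hK _ k L2Y) (sqint_affine c h)).2.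
apply: (@le_lt_trans _ _ ((ipK k k + 1) * E (fun o => (ipK k k + 1)^-1 * f o))).
  by rewrite (ExZ _ _ _ if_) mulrA divff ?mul1r// gt_eqF.
rewrite -ltr_pdivlMl// mulrC; apply: le_lt_trans gamY.
(* The squared distance in [gamY] is not shown to be measurable, but it lies between the rescaled
   [f] and an integrable function built from [|Y|^2] and [|V|^2]. *)
apply: (le_Ex_nonmeasurable _ _ _
  (fun o => 2 * (nrm2 ipK (Y o) + (a + b * nrm2 ipH (V o))))).
- move=> o; apply/andP; split.
    by apply: mulr_ge0; [rewrite invr_ge0 ltW|exact: sqr_ge0].
  rewrite -(ler_pM2l kp) mulrA divff ?gt_eqF// mul1r /f -gamk -(ipBl hK).
  apply: (le_trans (cauchy_schwarz hK _ _)); rewrite mulrC.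
  by rewrite ler_wpM2r ?(ip_ge0 hK)// lerDl.
- move=> o; apply: (le_trans (nrm2D_le hK _ _)).
  by rewrite (nrm2N hK) ler_wpM2l// lerD2l.
- apply/intgZ/intgD; first by case: L2Y.
  apply: intgD; first exact: intg_cst.
  by apply: intgZ; case: hV.
Qed.
End LinearConditioning.

(** * Orthogonality of the residuals of both projections *)

Section Orthogonality.
Context {R : realType} {d : measure_display} {Omega : measurableType d}.
Context {P : probability Omega R} {H : lmodType R} {ipH : H -> H -> R}.
Hypothesis hH : is_separable_hilbert ipH.
Context {V : Omega -> H}.
Hypothesis hV : L2 P (K := hspace ipH) V.

Local Notation E := (Ex P).

(** With [r] a residual and [Y] a projection, this supplies the vanishing cross terms of
    [cov_decomp]. *)
Lemma aff_closure_orth {K : lmodType R} {ipK : K -> K -> R}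
    (hK : is_separable_hilbert ipK) (r : Omega -> R) (Y : Omega -> K) (k : K) :
  sqint P r -> in_aff_closure P (H := hspace ipH) (K := hspace ipK) V Y ->
  (forall c h, E (fun o => r o * (c + ipH (V o) h)) = 0) ->
  E (fun o => r o * ipK (Y o) k) = 0.
Proof.
move=> hr clY orth; have [L2Y _] := clY.
apply: Ex_mul_closure => // [|e e0]; first exact: sqint_ip.
have [c [h yz]] := aff_closure_approx P hH hK V hV Y k e clY e0.
by exists (fun o => c + ipH (V o) h); split => //; exact: (sqint_affine P hH).
Qed.

Lemma lin_condexp_mean {K : lmodType R} {ipK : K -> K -> R}
    (hK : is_separable_hilbert ipK) (Z Y : Omega -> K) (k : K) :
  is_lin_condexp P (H := hspace ipH) (K := hspace ipK) V Z Y ->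
  E (fun o => ipK (Z o) k - ipK (Y o) k) = 0.
Proof.
move=> /(lin_condexp_orth P hH hK V _ _ 1 0 k) <-.
by congr (Ex P _); apply/funext => o; rewrite (ip0r hH) addr0 mulr1.
Qed.

Lemma sigmaV_generator h (B : set R) : measurable B ->
  sigmaV ipH V ((fun o => ipH (V o) h) @^-1` B).
Proof. by move=> mB; apply: sub_sigma_algebra; exists h, B. Qed.

Lemma sigmaV_measurable : sigmaV ipH V `<=` measurable.
Proof.
apply: smallest_sub; first exact: sigma_algebra_measurable.
move=> _ [h [B [mB ->]]]; rewrite -[X in measurable X]setTI.
by case: hV => _ /(_ h I) mVh _; exact: mVh.
Qed.

Lemma sigmaV_setT : sigmaV ipH V setT.
Proof. by rewrite -(preimage_setT (fun o => ipH (V o) 0)); exact: sigmaV_generator. Qed.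

Lemma Ex_indic (f : Omega -> R) (A : set Omega) :
  E (fun o => f o * \1_A o) = fine (\int[P]_(o in A) (f o)%:E).
Proof.
rewrite -[RHS]/(Rintegral P A f) Rintegral_mkcond; congr (Rintegral P setT _).
by apply/funext => o; rewrite patchE indicE; case: ifP; rewrite ?mulr1 ?mulr0.
Qed.

(** The defining identity of conditional expectation is orthogonality to indicators of sets in
    [sigmaV]; [Ex_mul_eq0] extends it to [z]. *)
Lemma condexp_orth {K : lmodType R} {ipK : K -> K -> R}
    (hK : is_separable_hilbert ipK) (Z Y : Omega -> K) (k : K) (z : Omega -> R) :
  L2 P (K := hspace ipK) Z -> is_condexp P ipH ipK V Z Y -> sqint P z ->
  (forall B : set R, measurable B -> sigmaV ipH V (z @^-1` B)) ->
  E (fun o => (ipK (Z o) k - ipK (Y o) k) * z o) = 0.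
Proof.
move=> L2Z [L2Y _ intZY] hz zV.
have hZ := sqint_ip hK _ k L2Z; have hY := sqint_ip hK _ k L2Y.
apply: (Ex_mul_eq0 P (fun o => ipK (Z o) k - ipK (Y o) k)) => //.
  exact: sqintB.
move=> B /zV; set A := _ @^-1` _ => VA.
have hA : sqint P \1_A.
  have mA : measurable_fun setT (\1_A : Omega -> R).
    by apply: measurable_indic; exact: sigmaV_measurable.
  split => //; apply: (intg_le _ _ (fun=> 1)); last exact: intg_cst.
  - exact: (measurable_funX 2 mA).
  - by move=> o; rewrite indicE; case: (_ \in _); rewrite ?expr1n ?expr0n ?normr1 ?normr0.
under eq_fun do rewrite mulrBl.
rewrite ExB; [|exact: sqint_mul..].
by rewrite !Ex_indic intZY// subrr.
Qed.

Lemma condexp_mean {K : lmodType R} {ipK : K -> K -> R}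
    (hK : is_separable_hilbert ipK) (Z Y : Omega -> K) (k : K) :
  L2 P (K := hspace ipK) Z -> is_condexp P ipH ipK V Z Y ->
  E (fun o => ipK (Z o) k - ipK (Y o) k) = 0.
Proof.
move=> L2Z [L2Y _ intZY].
have hZ := sqint_ip hK _ k L2Z; have hY := sqint_ip hK _ k L2Y.
rewrite ExB; [|exact: sqint_intg..].
by apply/eqP; rewrite subr_eq0 /Ex /Rintegral intZY//; exact: sigmaV_setT.
Qed.

(** Equality of means handles [c]; [condexp_orth] handles [<V, h>], whose Borel preimages generate
    [sigmaV]. *)
Lemma condexp_affine_orth {K : lmodType R} {ipK : K -> K -> R}
    (hK : is_separable_hilbert ipK) (Z Y : Omega -> K) (k : K) (c : R) (h : H) :
  L2 P (K := hspace ipK) Z -> is_condexp P ipH ipK V Z Y ->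
  E (fun o => (ipK (Z o) k - ipK (Y o) k) * (c + ipH (V o) h)) = 0.
Proof.
move=> L2Z hY; have [L2Y _ _] := hY.
have hr := sqintB _ _ _ (sqint_ip hK _ k L2Z) (sqint_ip hK _ k L2Y).
have hVh := sqint_ip hH _ h hV.
under eq_fun do rewrite mulrDr mulrC.
rewrite ExD ?ExZ; [|exact: sqint_intg|apply: intgZ; exact: sqint_intg|exact: sqint_mul].
rewrite condexp_mean// condexp_orth ?mulr0 ?addr0// => B mB.
exact: sigmaV_generator.
Qed.

End Orthogonality.

(** * Scalar forms of the covariance and of the mean of [CA] *)

Lemma is_cov_weak {R : realType} {d : measure_display} {Omega : measurableType d}
    {P : probability Omega R} {F G : lmodType R} {ipF : F -> F -> R} {ipG : G -> G -> R}
    (hF : is_separable_hilbert ipF) (hG : is_separable_hilbert ipG)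
    (U : Omega -> G) (W : Omega -> F) (C : F -> G) (f : F) (g : G) :
  is_cov P ipF ipG U W C ->
  ipG (C f) g = Ex P (fun o => (ipG (U o) g - Ex P (fun o => ipG (U o) g)) *
                               (ipF (W o) f - Ex P (fun o => ipF (W o) f))).
Proof.
move=> [mU [mW [[_ mUE] [_ mWE] [hC CE]]]].
rewrite -(ip_HS_tens hF hG)//.
have [_] := CE _ (is_HS_tens hF hG f g); rewrite /= => ->.
(* Testing the Bochner means against [g] and [f] identifies their pairings with the scalar means. *)
have [_ /= <-] := mUE g I; have [_ /= <-] := mWE f I.
congr (Ex P _); apply/funext => o.
rewrite (ip_HS_tens hF hG); last exact: is_HS_tens.
by rewrite /tens (ipZl hG) (ipBl hF) (ipBl hG) mulrC.
Qed.

Lemma lin_condcov_mean_weak {R : realType} {d : measure_display}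
    {Omega : measurableType d} {P : probability Omega R} {F G H : lmodType R}
    {ipF : F -> F -> R} {ipG : G -> G -> R} {ipH : H -> H -> R}
    (hF : is_separable_hilbert ipF) (hG : is_separable_hilbert ipG)
    (V : Omega -> H) (rU : Omega -> G) (rW : Omega -> F) (CA : Omega -> F -> G)
    (C : F -> G) (f : F) (g : G) :
  (forall k, sqint P (fun o => ipG (rU o) k)) ->
  (forall k, sqint P (fun o => ipF (rW o) k)) ->
  is_lin_condexp P (H := hspace ipH) (K := HSspace ipF ipG) V
    (fun o => tens ipF (rU o) (rW o)) CA ->
  is_mean P (K := HSspace ipF ipG) CA C ->
  ipG (C f) g = Ex P (fun o => ipG (rU o) g * ipF (rW o) f).
Proof.
move=> hU hW [[[HSCA _ _] _] orth] [HSC CE].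
have HSt := is_HS_tens hF hG f g.
rewrite -(ip_HS_tens hF hG)//.
have [] := CE _ HSt; rewrite /= => iCA ->.
have CAE o : ip_HS ipF ipG (CA o) (tens ipF g f) = ipG (CA o f) g.
  by rewrite (ip_HS_tens hF hG)//; exact: HSCA.
move: iCA; under eq_fun do rewrite CAE; move=> iCA.
have iUW := sqint_mul _ _ _ (hU g) (hW f).
(* Constant maps are affine with zero linear part; testing the residual against [tens ipF g f]
   equates the [(f, g)] entries of the two means. *)
have aff : bounded_affine (H := hspace ipH) (K := HSspace ipF ipG)
    (fun=> tens ipF g f).
  exists (tens ipF g f), (fun=> 0); split => //.
  - by move=> a x y; rewrite scaler0 addr0.
  - by move=> h; exact: is_HS0.
  - by exists 0 => h; rewrite mul0r /nrm2 /= /ip_HS addr0 subr0 subrr mul0r.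
  - by move=> h; rewrite addr0.
have := orth _ aff.
under eq_fun => o.
  rewrite /= (ip_HS_tens hF hG); last first.
    by apply: is_HSB => //; [exact: is_HS_tens|exact: HSCA].
  change ((tens ipF (rU o) (rW o) - CA o) f) with (ipF (rW o) f *: rU o - CA o f).
  rewrite (ipBl hG) (ipZl hG) mulrC.
  over.
rewrite ExB// => /eqP; rewrite subr_eq0 => /eqP ->.
by congr (Ex P _); apply/funext => o; exact: CAE.
Qed.

(** * The covariance identity and the Loewner chain *)

Theorem mainTheorem5 (R : realType) (d : measure_display) (Omega : measurableType d)
  (P : probability Omega R)
  (F G H : lmodType R) (ipF : F -> F -> R) (ipG : G -> G -> R) (ipH : H -> H -> R)
  (hF : is_separable_hilbert ipF) (hG : is_separable_hilbert ipG)
  (hH : is_separable_hilbert ipH)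
  (U : Omega -> G) (V : Omega -> H) (W : Omega -> F)
  (hU : L2 P (K := hspace ipG) U) (hV : L2 P (K := hspace ipH) V)
  (hW : L2 P (K := hspace ipF) W)
  (* versions of E^A[U|V], E^A[W|V] *)
  (YU : Omega -> G) (YW : Omega -> F)
  (hYU : is_lin_condexp P (H := hspace ipH) (K := hspace ipG) V U YU)
  (hYW : is_lin_condexp P (H := hspace ipH) (K := hspace ipF) V W YW)
  (* assumption: R^A[U|V] (x) R^A[W|V] in L^2(P; L_2(F;G)) *)
  (hRR : L2 P (K := HSspace ipF ipG) (fun w => tens ipF (U w - YU w) (W w - YW w)))
  (* a version of Cov^A[U,W|V] = E^A[R^A[U|V] (x) R^A[W|V] | V] *)
  (CA : Omega -> (F -> G))
  (hCA : is_lin_condexp P (H := hspace ipH) (K := HSspace ipF ipG) V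
           (fun w => tens ipF (U w - YU w) (W w - YW w)) CA)
  (* a version of E[U|V] *)
  (YC : Omega -> G) (hYC : is_condexp P ipH ipG V U YC) :
  (forall (C C1 C2 : F -> G),
     is_cov P ipF ipG U W C -> is_cov P ipF ipG YU YW C1 ->
     is_mean P (K := HSspace ipF ipG) CA C2 ->
     C = C1 + C2) /\
  (forall (CU CE CEA : G -> G),
     is_cov P ipG ipG U U CU -> is_cov P ipG ipG YC YC CE ->
     is_cov P ipG ipG YU YU CEA ->
     [/\ loewner_le ipG CE CU, loewner_le ipG CEA CE & loewner_le ipG 0 CEA]).
Proof.
have [clYU _] := hYU; have [clYW _] := hYW; have [L2YC mYC _] := hYC.
have [[L2YU _] [L2YW _]] := (clYU, clYW).
have sU g := sqint_ip hG U g hU; have sW f := sqint_ip hF W f hW.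
have sYU g := sqint_ip hG YU g L2YU; have sYW f := sqint_ip hF YW f L2YW.
have sYC g := sqint_ip hG YC g L2YC.
have srU g := sqintB _ _ _ (sU g) (sYU g).
have srW f := sqintB _ _ _ (sW f) (sYW f).
have meanU g : Ex P (fun o => ipG (U o) g) = Ex P (fun o => ipG (YU o) g).
  have := lin_condexp_mean hH hG U YU g hYU.
  by rewrite ExB; [move/eqP; rewrite subr_eq0 => /eqP|exact: sqint_intg..].
have meanW f : Ex P (fun o => ipF (W o) f) = Ex P (fun o => ipF (YW o) f).
  have := lin_condexp_mean hH hF W YW f hYW.
  by rewrite ExB; [move/eqP; rewrite subr_eq0 => /eqP|exact: sqint_intg..].
have meanC g : Ex P (fun o => ipG (U o) g) = Ex P (fun o => ipG (YC o) g).
  have := condexp_mean hG U YC g hU hYC.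
  by rewrite ExB; [move/eqP; rewrite subr_eq0 => /eqP|exact: sqint_intg..].
split=> [C C1 C2 covUW covY meanCA|CU CE CEA covU covYC covYU].
  apply/funext => f; apply: (ip_inj hG) => g.
  change ((C1 + C2) f) with (C1 f + C2 f).
  rewrite (ipDl hG) (is_cov_weak hF hG U W C f g covUW).
  (* Equality of means lets both covariances be centred at the same constants, as in
     [cov_decomp]. *)
  rewrite (is_cov_weak hF hG YU YW C1 f g covY) -meanU -meanW.
  rewrite (lin_condcov_mean_weak hF hG V (fun o => U o - YU o)
    (fun o => W o - YW o) CA C2 f g _ _ hCA meanCA).
  - under [in X in _ + X]eq_fun do rewrite (ipBl hG) (ipBl hF).
    apply: (cov_decomp P (fun o => ipG (U o) g) (fun o => ipF (W o) f)) => //.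
    + exact: lin_condexp_mean hYU.
    + exact: lin_condexp_mean hYW.
    + apply: (aff_closure_orth hH hV hF _ YW) => // c h.
      exact: lin_condexp_orth hYU.
    + apply: (aff_closure_orth hH hV hG _ YU) => // c h.
      exact: lin_condexp_orth hYW.
  - by move=> k; under eq_fun do rewrite (ipBl hG).
  - by move=> k; under eq_fun do rewrite (ipBl hF).
split=> g.
- rewrite (ipBl hG) subr_ge0 (is_cov_weak hG hG _ _ _ g g covU).
  rewrite (is_cov_weak hG hG _ _ _ g g covYC) -meanC.
  apply: var_le => //; first exact: condexp_mean hYC.
  (* [<YC, g>] is itself [sigmaV]-measurable, hence an admissible test function. *)
  apply: (condexp_orth hV hG _ _ g _ hU hYC) => // B mB; exact: mYC.
- rewrite (ipBl hG) subr_ge0 (is_cov_weak hG hG _ _ _ g g covYC).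
  rewrite (is_cov_weak hG hG _ _ _ g g covYU) -meanC -meanU.
  have sd := sqintB _ _ _ (sYC g) (sYU g).
  apply: var_le => //.
    by rewrite ExB; [rewrite -meanC -meanU subrr|exact: sqint_intg..].
  (* [YC - YU = (U - YU) - (U - YC)]: both residuals are orthogonal to affine functions of [V],
     hence so is their difference, and [YU] lies in the closure. *)
  apply: (aff_closure_orth hH hV hG _ YU) => // c h.
  have sz := sqint_affine P hH V hV c h.
  have := lin_condexp_orth P hH hG V U YU c h g hYU.
  have := condexp_affine_orth hH hV hG U YC g c h hU hYC.
  set z := fun o => c + _ in sz *.
  under eq_fun do rewrite mulrBl; rewrite ExB; [|exact: sqint_mul..].
  move=> e1; under eq_fun do rewrite mulrBl; rewrite ExB; [|exact: sqint_mul..].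
  move=> e2; under eq_fun do rewrite mulrBl; rewrite ExB; [|exact: sqint_mul..].
  lra.
- change ((0 : G -> G) g) with (0 : G).
  rewrite subr0 (is_cov_weak hG hG _ _ _ g g covYU).
  by apply: Ex_ge0 => o; rewrite -expr2 sqr_ge0.
Qed.
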